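(* Let $G$ be a finite group and let $\mathcal{C}$ be a conjugacy class of $G$. If every $7$ members of $\mathcal{C}$ generate a solvable subgroup, then $\mathcal{C}$ generates a solvable subgroup.
   Context: ''Every $7$ members of $\mathcal{C}$ generate a solvable subgroup'' means that for all $x_1,\dots,x_7\in\mathcal{C}$ (not necessarily distinct) the subgroup $\langle x_1,\dots,x_7\rangle$ is solvable. *)

(* Defs.v *)
Set Implicit Arguments.
Unset Strict Implicit.
Unset Printing Implicit Defensive.

(* Main.v *)
(* By Baer-Suzuki it is enough to find, unless C = 1, a nontrivial p-element u
   such that <u, u^g> is always a p-group; then O_p(G) <> 1 and one concludes by
   induction in G / O_p(G).

   Call D_i the lower nilpotent series (D_0 H = H and D_(i+1) H is the nilpotent
   residual of D_i H). The key fact is that a solvable group H generated by a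
   normal subset S with D_i H <> 1 has five elements of S generating a subgroup
   A with D_i A <> 1. Given this, let h be maximal with D_h A <> 1 for some A
   generated by five members of C. For h > 0, some p-element w of D_h A and some
   generator y of A in C do not commute, and u = [w, y] = (y^w)^-1 y lies in a
   subgroup generated by two members of C. So A and u^g lie in a group T
   generated by seven members of C, and D_h T is nilpotent by the key fact and
   the choice of h; hence u is in O_p(T), and <u, u^g> is a p-group. For h = 0 all
   such T are nilpotent and u is a power of x.

   In a minimal counterexample to the key fact, H = K V with V = D_i H an
   elementary abelian minimal normal subgroup, K = <x_1, .., x_5> a faithful
   irreducible complement of V generated by a single K-class containing the
   x_j, and D_(i-1) K a nontrivial p'-group. All lifts x_j^(v_j) must generate
   complements, hence be conjugate under V to (x_j), which forces
   |V|^5 <= |V| |C_V(x)|^5. This contradicts |C_V(x)|^4 <= |V|^3, which holds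
   for every x whose K-class generates the solvable irreducible group K. That
   bound comes from finding m = [x, g] with |C_V(m)|^2 <= |V|, as
   C_V(x) and C_V(x^g) meet inside C_V(m). *)

Require Import Defs.
From mathcomp Require Import all_boot all_fingroup all_solvable.

Set Implicit Arguments.
Unset Strict Implicit.
Unset Printing Implicit Defensive.

Import GroupScope.

(** * The lower nilpotent series *)

(** The limit of the lower central series, that is, the nilpotent residual: the series starts at
    index 1 and is stationary after at most [#|A|] steps. *)
Definition nilres (gT : finGroupType) (A : {set gT}) : {set gT} := 'L_#|A|.+1(A).

Canonical nilres_group (gT : finGroupType) (G : {group gT}) :=
  Eval hnf in [group of nilres G].

Section NilpotentResidual.

Variable gT : finGroupType.
Implicit Types (G H K N M W : {group gT}) (n i : nat).

Lemma lcn_stable n G : #|G| <= n -> 'L_n.+2(G) = 'L_n.+1(G).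
Proof.
have stab m k : 'L_m.+2(G) = 'L_m.+1(G) -> 'L_(k + m).+2(G) = 'L_(k + m).+1(G).
  by move=> Lm; elim: k => // k IHk; rewrite addSn lcnSn IHk.
suffices [m ltmG Lm]: exists2 m, m < #|G| & 'L_m.+2(G) = 'L_m.+1(G).
  by move=> leGn; rewrite -(subnK (leq_trans (ltnW ltmG) leGn)); apply: stab.
have [/existsP[m /eqP Lm]|] := boolP [exists m : 'I_#|G|, 'L_m.+2(G) == 'L_m.+1(G)].
  by exists m.
move/existsPn=> ne.
have: forall m, m <= #|G| -> #|'L_m.+1(G)| + m <= #|G|.
  elim=> [|m IHm] ltmG; first by rewrite addn0 lcn1.
  rewrite addnS; apply: leq_trans (IHm (ltnW ltmG)); rewrite ltn_add2r.
  by apply: proper_card; rewrite properEneq lcn_subS andbT (ne (Ordinal ltmG)).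
by move/(_ _ (leqnn _)); rewrite leqNgt -[X in X < _]add0n ltn_add2r cardG_gt0.
Qed.

(** This lets subgroups and quotients of a group be compared with it at one common index. *)
Lemma nilres_lcn n G : #|G| <= n -> nilres G = 'L_n.+1(G).
Proof.
move/subnK <-; elim: (n - #|G|) => // m IHm.
by rewrite addSn lcn_stable // leq_addl.
Qed.

Lemma nilres_char G : nilres G \char G. Proof. exact: lcn_char. Qed.

Lemma nilres_sub G : nilres G \subset G. Proof. exact: lcn_sub. Qed.

Lemma nilresS G H : G \subset H -> nilres G \subset nilres H.
Proof.
by move=> sGH; rewrite (@nilres_lcn #|H| G) ?subset_leq_card // lcnS.
Qed.

Lemma nilres_comm G : [~: nilres G, G] = nilres G.
Proof. by rewrite -lcnSn lcn_stable. Qed.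

Lemma nilres_eq1 G : (nilres G :==: 1) = nilpotent G.
Proof.
apply/eqP/idP=> [R1 | nilG]; first by apply/lcnP; exists #|G|.
by apply/lcn_nil_classP; rewrite // ltnW -?nilpotent_class.
Qed.

Lemma nilres_proper G : solvable G -> G :!=: 1 -> nilres G \proper G.
Proof.
move=> solG ntG; apply: sub_proper_trans (sol_der1_proper solG _ ntG) => //.
by rewrite -lcn2 lcn_sub_leq // ltnS cardG_gt0.
Qed.

End NilpotentResidual.

Section NilpotentResidualQuotient.

Variable gT : finGroupType.
Implicit Types (G H K N M W : {group gT}) (n i : nat).

Lemma quotient_nilres G N : G \subset 'N(N) -> nilres G / N = nilres (G / N).
Proof.
move=> nNG; have := @nilres_lcn _ #|G| (G / N)%G (leq_quotient _ _).
by rewrite [nilres G / N]morphim_lcn.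
Qed.

Lemma nilres_sub_quo G N :
  G \subset 'N(N) -> (nilres G \subset N) = nilpotent (G / N).
Proof.
move=> nNG; rewrite -nilres_eq1 /= -quotient_nilres // -subG1 quotient_sub1 //.
exact: subset_trans (nilres_sub G) nNG.
Qed.

(** Modulo the join of the two residuals, [N] and [M] become nilpotent normal subgroups, hence lie
    in the Fitting subgroup, and so does their join. *)
Lemma nilres_mul G N M :
  N <| G -> M <| G -> nilres (N <*> M) = nilres N <*> nilres M.
Proof.
move=> nsNG nsMG; have [sNG nNG] := andP nsNG; have [sMG nMG] := andP nsMG.
apply/eqP; rewrite eqEsubset andbC join_subG !nilresS ?joing_subl ?joing_subr //=.
have nsRG: nilres N <*> nilres M <| G.
  by rewrite normalY ?(char_normal_trans (nilres_char _)).
have [_ nRG] := andP nsRG.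
have sNMG: N <*> M \subset G by rewrite join_subG sNG.
rewrite nilres_sub_quo ?(subset_trans sNMG) //.
have nsq K : K <| G -> nilres K \subset nilres N <*> nilres M ->
    K / (nilres N <*> nilres M) \subset 'F(G / (nilres N <*> nilres M)).
  move=> nsKG sRK; apply: Fitting_max; first exact: quotient_normal.
  by rewrite -nilres_sub_quo ?(subset_trans (normal_sub nsKG)).
apply: nilpotentS (Fitting_nil (G / (nilres N <*> nilres M))) => /=.
rewrite quotientY ?(subset_trans _ nRG) //.
by rewrite join_subG !nsq ?joing_subl ?joing_subr.
Qed.

End NilpotentResidualQuotient.

Fixpoint nilser i (gT : finGroupType) (G : {group gT}) : {group gT} :=
  if i is i'.+1 then [group of nilres (nilser i' G)] else G.

Section LowerNilpotentSeries.

Variable gT : finGroupType.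
Implicit Types (G H K N M W : {group gT}) (n i : nat).

Lemma nilser_char i G : nilser i G \char G.
Proof.
by elim: i => [|i IHi]; [exact: char_refl | exact: char_trans (nilres_char _) IHi].
Qed.

Lemma nilser_sub i G : nilser i G \subset G. Proof. exact/char_sub/nilser_char. Qed.

Lemma nilser_norm i G : G \subset 'N(nilser i G).
Proof. exact/char_norm/nilser_char. Qed.

Lemma nilserS i G H : G \subset H -> nilser i G \subset nilser i H.
Proof. by move=> sGH; elim: i => //= i; apply: nilresS. Qed.

Lemma nilser_decr i j G : i <= j -> nilser j G \subset nilser i G.
Proof.
move/subnK <-; elim: {j}(j - i) => //= j; apply: subset_trans; exact: nilres_sub.
Qed.

Lemma quotient_nilser i G N :
  G \subset 'N(N) -> nilser i G / N = nilser i (G / N) :> {set _}.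
Proof.
move=> nNG; elim: i => //= i IHi.
rewrite quotient_nilres ?(subset_trans (nilser_sub i G)) //.
by congr (nilres _).
Qed.

Lemma nilser_mul i G N M : N <| G -> M <| G ->
  nilser i (N <*> M) = nilser i N <*> nilser i M :> {set _}.
Proof.
move=> nsNG nsMG; elim: i => //= i IHi.
rewrite -(@nilres_mul _ G) ?(char_normal_trans (nilser_char _ _)) //.
by rewrite IHi.
Qed.

(** By solvability each nontrivial term strictly contains the next. This bounds the heights among
    which a maximal one is chosen later. *)
Lemma nilser_sol_eq1 i G : solvable G -> #|G| <= i -> nilser i G :=: 1.
Proof.
move=> solG leGi; apply/eqP; apply: contraLR leGi; rewrite -ltnNge.
elim: i => [|i IHi] ntD; first exact: cardG_gt0.
suffices: #|nilser i.+1 G| + i.+1 <= #|G|.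
  by apply: leq_trans; rewrite -{1}[i.+1]add0n ltn_add2r cardG_gt0.
elim: i.+1 ntD => {i IHi} [|i IHi] ntD; first by rewrite addn0.
have ntDi: nilser i G :!=: 1.
  by apply: contraNneq ntD => D1; rewrite -subG1 -D1 nilser_decr.
rewrite addnS; apply: leq_trans (IHi ntDi); rewrite ltn_add2r proper_card //=.
exact: nilres_proper (solvableS (nilser_sub i G) solG) ntDi.
Qed.

End LowerNilpotentSeries.

(** * Fixed points in irreducible modules *)

Section CoprimeAbelian.

Variable gT : finGroupType.
Implicit Types A V : {group gT}.

(** [A] acts trivially on [V / [~: V, A]], and by coprimality the fixed points of this quotient lift
    to [V]. *)
Lemma coprime_abelian_comm_cent_mul A V :
    A \subset 'N(V) -> coprime #|V| #|A| -> abelian V ->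
  [~: V, A] * 'C_V(A) = V.
Proof.
move=> nVA coVA cVV; have sRV: [~: V, A] \subset V by rewrite commg_subl.
have nRA: A \subset 'N([~: V, A]) by rewrite commg_normr.
have nRV: V \subset 'N([~: V, A]) by rewrite commg_norml.
apply/eqP; rewrite eqEsubset mul_subG ?subsetIl //=.
rewrite -quotientSK // (coprime_quotient_cent sRV nRA coVA (abelian_sol cVV)).
by rewrite subsetI subxx quotient_cents2r.
Qed.

Lemma coprime_abelian_comm_cent_card A V :
    A \subset 'N(V) -> coprime #|V| #|A| -> abelian V ->
  (#|[~: V, A]| * #|'C_V(A)|)%N = #|V|.
Proof.
move=> nVA coVA cVV; rewrite -[in RHS](coprime_abelian_comm_cent_mul nVA) //.
rewrite TI_cardMg //; apply/trivgP.
rewrite -(coprime_abel_cent_TI nVA coVA cVV) subsetI subsetIl.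
by rewrite (subset_trans (subsetIr _ _)) ?subsetIr.
Qed.

End CoprimeAbelian.

Section IrreducibleAction.

Variable gT : finGroupType.
Implicit Types (A H K M N Q R U V W : {group gT}) (x g n : gT).

Lemma card_cent1_commg V x g : x \in 'N(V) -> g \in 'N(V) ->
  #|'C_V[x]| ^ 2 <= #|V| * #|'C_V[[~ x, g]]|.
Proof.
move=> nVx nVg.
have cardJ: #|'C_V[x ^ g]| = #|'C_V[x]|.
  by rewrite cent1J -{1}(normP nVg) -conjIg cardJg.
rewrite expnS expn1 -{2}cardJ mul_cardG leq_mul ?subset_leq_card //.
  by rewrite mul_subG ?subsetIl.
apply/subsetP=> v /setIP[/setIP[Vv cxv] /setIP[_ cxgv]].
rewrite inE Vv commgEl; apply/cent1P; apply: commuteM.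
  by apply: commuteV; apply/cent1P.
exact/cent1P.
Qed.

Lemma minnormal_TI_or_eq V K U :
  minnormal V K -> U \subset V -> K \subset 'N(U) -> U :=: 1 \/ U :=: V.
Proof.
case/mingroupP=> _ minV sUV nUK; have [U1 | ntU] := eqVneq U 1%G.
  by left; rewrite U1.
by right; apply: minV => //; rewrite nUK andbT.
Qed.

(** ['C_V(N)] is [K]-invariant, so it is [1] or [V]; faithfulness excludes [V]. *)
Lemma minnormal_cent_normal V K N : minnormal V K -> 'C_K(V) = 1 ->
  N <| K -> N :!=: 1 -> 'C_V(N) = 1.
Proof.
move=> minV cKV /andP[sNK nNK] ntN; have /andP[_ nVK] := mingroupp minV.
have nCK: K \subset 'N('C_V(N)) by rewrite normsI ?norms_cent.
have [] // := minnormal_TI_or_eq minV (subsetIl _ _) nCK.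
move/setIidPl=> cVN; case/negP: ntN; rewrite -subG1 -cKV subsetI sNK.
by rewrite centsC.
Qed.

Lemma minnormal_cent1 V K z : minnormal V K -> 'C_K(V) = 1 ->
  z \in 'Z(K) -> z != 1 -> 'C_V[z] = 1.
Proof.
move=> minV cKV Zz ntz; rewrite -cent_cycle; apply: minnormal_cent_normal cKV _ _ => //.
  by apply: sub_center_normal; rewrite cycle_subG.
by rewrite cycle_eq1.
Qed.

(* [V] is the direct product of the ['C_V(R^k)], permuted by [n] without fixed
   points, so an [n]-fixed element is determined by its components over a
   transversal [X] of the [n]-orbits; ['C_V(R^k)] has complement [[~: V, R^k]]. *)
Lemma card_cent1_imprimitive V K Q R n :
    minnormal V K -> abelian V -> coprime #|V| #|Q| -> abelian Q ->
    K \subset 'N(Q) -> Q \subset K ->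
    R \subset Q -> 'C_V(R) != 1 ->
    (forall R', R' \subset Q -> 'C_V(R') != 1 -> R \subset R' -> R' \subset R) ->
    n \in K -> (forall k, k \in K -> n \notin 'N(R :^ k)) ->
  #|'C_V[n]| ^ 2 <= #|V|.
Proof.
move=> minV cVV coVQ cQQ nQK sQK sRQ ntCR maxR Kn moves.
have [/andP[ntV nVK] _] := mingroupP minV; pose Om := R :^: K; pose u := #|'C_V(R)|.
have nVR: R \subset 'N(V) by rewrite (subset_trans sRQ) ?(subset_trans sQK).
have coVR: coprime #|V| #|R| := coprimegS sRQ coVQ.
have OmP S: S \in Om -> exists2 k, k \in K & S = R :^ k by case/imsetP=> k; exists k.
have OmE S: S \in Om -> [/\ S \subset Q, #|'C_V(S)| = u,
     (#|[~: V, S]| * u)%N = #|V| & [~: V, S] :&: 'C_V(S) = 1].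
  case/OmP=> k Kk ->.
  have VJ: V :^ k = V by rewrite (normsP nVK).
  have CJ: 'C_V(R :^ k) = 'C_V(R) :^ k by rewrite conjIg VJ centJ.
  have RJ: [~: V, R :^ k] = [~: V, R] :^ k by rewrite conjsRg VJ.
  rewrite CJ RJ !cardJg; split=> //.
  - by rewrite -(normsP nQK k Kk) conjSg.
  - exact: coprime_abelian_comm_cent_card.
  rewrite -conjIg -(conjs1g k); congr (_ :^ k); apply/trivgP.
  rewrite -(coprime_abel_cent_TI nVR coVR cVV) subsetI subsetIl.
  by rewrite (subset_trans (subsetIr _ _)) ?subsetIr.
have OmJ S k: S \in Om -> k \in K -> S :^ k \in Om.
  by case/OmP=> h Kh -> Kk; rewrite -conjsgM imset_f ?groupM.
(* Split ['C_V(S)] under [T]: the part fixed by [T] is centralised by [S] and [T] together, so by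
   maximality of [R] it is nontrivial only if [S = T]. *)
have sub_comm S T: S \in Om -> T \in Om -> S != T -> 'C_V(S) \subset [~: V, T].
  case/OmP=> h Kh -> /OmP[k Kk ->{T}] neST.
  have sSQ: R :^ h \subset Q by rewrite -(normsP nQK h Kh) conjSg.
  have sTQ: R :^ k \subset Q by rewrite -(normsP nQK k Kk) conjSg.
  have nVT: R :^ k \subset 'N(V) by rewrite (subset_trans sTQ) ?(subset_trans sQK).
  have nUT: R :^ k \subset 'N('C_V(R :^ h)).
    by rewrite normsI // norms_cent // cents_norm // (centSS sTQ sSQ).
  have coUT: coprime #|'C_V(R :^ h)| #|R :^ k|.
    by rewrite (coprimeSg (subsetIl _ _)) // (coprimegS sTQ).
  have cUU: abelian 'C_V(R :^ h) := abelianS (subsetIl _ _) cVV.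
  rewrite -(coprime_abelian_comm_cent_mul nUT coUT cUU) /=.
  suffices ->: 'C_('C_V(R :^ h))(R :^ k) = 1 by rewrite mulg1 commSg ?subsetIl.
  apply/eqP; apply: contraNT neST; rewrite -setIA -centU -cent_gen => ntC.
  suffices sub_eq m l: m \in K -> l \in K ->
      'C_V(<<R :^ m :|: R :^ l>>) != 1 -> R :^ m \subset R :^ l.
  - by rewrite eqEsubset !sub_eq // setUC.
  move=> Km Kl; pose W := <<R :^ m :|: R :^ l>>%G => ntCW; have Kl' := groupVr Kl.
  have [sRmW sRlW]: R :^ m \subset W /\ R :^ l \subset W.
    by split; rewrite sub_gen ?subsetUl ?subsetUr.
  apply: subset_trans sRmW _; rewrite -[W : {set _}](conjsgKV l) conjSg.
  apply: (maxR (W :^ l^-1)%G); last by rewrite -sub_conjg.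
    rewrite -(normsP nQK _ Kl') conjSg gen_subG subUset.
    by rewrite -{1}(normsP nQK m Km) -{2}(normsP nQK l Kl) !conjSg sRQ.
  by rewrite /= centJ -{1}(normsP nVK _ Kl') -conjIg conjsg_eq1.
have capOm: V :&: \bigcap_(S in Om) [~: V, S] = 1.
  have nCK: K \subset 'N(V :&: \bigcap_(S in Om) [~: V, S]).
    rewrite normsI //; apply/subsetP=> k Kk; rewrite inE; apply/subsetP=> v.
    rewrite mem_conjg => /bigcapP Cv; apply/bigcapP=> S OmS.
    have := Cv _ (OmJ S k^-1 OmS (groupVr Kk)).
    by rewrite -{1}(normsP nVK k^-1) ?groupV // -conjsRg memJ_conjg.
  have [] // := minnormal_TI_or_eq minV (subsetIl _ _) nCK.
  move/setIidPl=> sVC; case/negP: ntCR; have OmR: (R : {set gT}) \in Om.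
    by apply/imsetP; exists 1; rewrite ?conjsg1.
  have sCR: V :&: \bigcap_(S in Om) [~: V, S] \subset [~: V, R].
    by apply/subsetP=> v /setIP[_ /bigcapP]; apply.
  have [_ _ _ tiR] := OmE R OmR; rewrite -subG1 -tiR subsetI subxx andbT.
  rewrite (subset_trans (subsetIl _ _)) // (subset_trans _ sCR) //.
  by rewrite subsetI subxx.
(* Each [[~: V, S]] has index [u] in [V], so every further one cuts the intersection by a factor of
   at most [u]. *)
have leA (l : seq {set gT}) : {subset l <= Om} ->
    #|V| <= #|V :&: \bigcap_(S in l) [~: V, S]| * u ^ size l.
  elim: l => [|S l IHl] sl; first by rewrite big_pred0_eq setIT muln1.
  have OmS: S \in Om by rewrite sl ?mem_head.
  have [_ _ oS _] := OmE S OmS; have /IHl le_l: {subset l <= Om}.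
    by move=> T lT; rewrite sl // inE lT orbT.
  pose B := [group of V :&: \bigcap_(S in l) [~: V, S]].
  apply: leq_trans (_ : #|[~: V, S] :&: B| * u ^ (size l).+1 <= _); last first.
    rewrite leq_mul2r subset_leq_card ?orbT //; apply/subsetP=> v.
    case/setIP=> RSv /setIP[Vv /bigcapP Rv]; rewrite inE Vv; apply/bigcapP=> T.
    by rewrite inE => /predU1P[-> | /Rv].
  rewrite -(leq_pmul2l (cardG_gt0 V)) -{1}oS expnS.
  apply: leq_trans (leq_mul (leqnn _) (le_l : _ <= #|B| * _)) _.
  have leAB: #|[~: V, S]| * #|B| <= #|V| * #|[~: V, S] :&: B|.
    rewrite mul_cardG leq_mul2r subset_leq_card ?orbT //.
    have [k Kk ->] := OmP S OmS; apply: mul_subG; last exact: subsetIl.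
    by rewrite commg_subl -(normsP nVK k Kk) normJ conjSg.
  by rewrite mulnACA (mulnA #|V|) leq_mul.
(* The fixed-point subgroups are independent: the product [W] of those already taken lies in the
   next [[~: V, S]], which meets ['C_V(S)] trivially. *)
have leB (l : seq {set gT}) : uniq l -> {subset l <= Om} -> u ^ size l <= #|V|.
  move=> Ul sl; suffices [W [sWV leW _]]: exists W : {group gT}, [/\ W \subset V,
      u ^ size l <= #|W| & forall S, S \in Om -> S \notin l -> W \subset [~: V, S]].
    exact: leq_trans leW (subset_leq_card sWV).
  elim: l Ul sl => [|S l IHl] /=.
    by exists 1%G; rewrite sub1G cards1; split=> // S; rewrite sub1G.
  case/andP=> lS Ul sl; have OmS: S \in Om by rewrite sl ?mem_head.
  have [|W [sWV leW sWc]] := IHl Ul; first by move=> T lT; rewrite sl // inE lT orbT.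
  have [_ oCS _ tiS] := OmE S OmS.
  exists (W <*> 'C_V(S))%G; split.
  - by rewrite join_subG sWV subsetIl.
  - rewrite /= cent_joinEr; last by rewrite (centSS (subsetIl _ _) sWV).
    rewrite TI_cardMg; first by rewrite oCS expnSr leq_mul.
    by apply/trivgP; rewrite -tiS setSI // sWc.
  move=> T OmT; rewrite inE negb_or => /andP[neTS lT].
  by rewrite join_subG sWc //= sub_comm // eq_sym.
(* [n] fixes no member of [Om], so a transversal of its orbits is disjoint from its translate by
   [n]. *)
have [X [sXOm cardX coverX]]: exists X : {set {set gT}}, [/\ X \subset Om,
    (#|X| * 2 <= #|Om|)%N & forall S, S \in Om -> exists j, S :^ (n ^+ j) \in X].
  have actsOm: [acts <[n]>, on Om | 'Js].
    rewrite (subset_trans _ (_ : K \subset _)) ?cycle_subG //.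
    apply/subsetP=> k Kk; rewrite !inE /=; apply/subsetP=> S OmS; rewrite inE /=.
    exact: OmJ.
  have [_ sXOm neqX coverX] := orbit_transversalP actsOm.
  set X := orbit_transversal _ _ _ in sXOm neqX coverX.
  exists X; split=> //; last first.
    by move=> S /coverX[_ /cycleP[j ->] XS]; exists j.
  have oXn: #|[set S :^ n | S in X]| = #|X| by rewrite card_imset //; apply: conjsg_inj.
  rewrite muln2 -addnn -{2}oXn -leq_subRL ?subset_leq_card //.
  rewrite -cardsDS // subset_leq_card //; apply/subsetP=> _ /imsetP[S XS ->].
  have OmS := subsetP sXOm S XS; rewrite inE OmJ // andbT.
  apply/negP=> XSn; have: (S :^ n == S).
    by rewrite eq_sym -neqX //; apply/imsetP; exists n; rewrite ?cycle_id.
  have [k Kk defS] := OmP S OmS.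
  by move/eqP=> nSn; case/negP: (moves k Kk); rewrite inE -defS nSn.
have ti: 'C_V[n] :&: (V :&: \bigcap_(S in enum X) [~: V, S]) = 1.
  apply/trivgP; rewrite -capOm; apply/subsetP=> v.
  case/setIP=> /setIP[Vv cnv] /setIP[_ /bigcapP Xv].
  rewrite inE Vv; apply/bigcapP=> S /coverX[j]; rewrite -mem_enum => /Xv.
  have Knj: n ^+ j \in K by rewrite groupX.
  rewrite /= -{1}(normsP nVK _ Knj) -conjsRg -{1}(_ : v ^ (n ^+ j) = v) ?memJ_conjg //.
  by apply/conjg_fixP/commgP; apply: commuteX; apply/cent1P.
have le1: #|'C_V[n]| <= u ^ #|X|.
  pose B := [group of V :&: \bigcap_(S in enum X) [~: V, S]].
  rewrite -(leq_pmul2r (cardG_gt0 B)) -TI_cardMg //; apply: leq_trans (_ : #|V| <= _).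
    by rewrite subset_leq_card // mul_subG ?subsetIl.
  rewrite mulnC [#|X|]cardE; apply: leA => S; rewrite mem_enum.
  exact: (subsetP sXOm).
apply: leq_trans (_ : (u ^ #|X|) ^ 2 <= _); first by rewrite leq_exp2r.
rewrite -expnM; apply: leq_trans (_ : u ^ #|Om| <= _).
  by rewrite leq_pexp2l ?cardG_gt0.
by rewrite [#|Om|]cardE leB ?enum_uniq // => S; rewrite mem_enum.
Qed.

End IrreducibleAction.

Lemma class_gen_cent (gT : finGroupType) (B : {set gT}) (K : {group gT}) x :
  <<x ^: K>> = K -> K \subset 'N(B) -> x \in 'C(B) -> K \subset 'C(B).
Proof.
by move=> defK nBK cBx; rewrite -{1}defK gen_subG class_sub_norm ?norms_cent.
Qed.

Section ClassGenerated.

Variable gT : finGroupType.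
Implicit Types (A H K M N Q R S V : {group gT}) (x g n : gT).

(* [n] lies outside the kernel in a minimal normal subgroup of the primitive
   quotient [K / core M], and such a subgroup is regular. *)
Lemma class_gen_moves K S x :
    solvable K -> x \in K -> <<x ^: K>> = K -> S \proper K ->
  exists2 n, n = x \/ (exists2 g, g \in K & n = [~ x, g])
           & forall k, k \in K -> n \notin S :^ k.
Proof.
move=> solK Kx defK prSK; have [sSK neSK] := andP prSK.
have [eqSK | [M /maxgroupP[prMK maxM] sSM]] := maximal_exists sSK.
  by rewrite eqSK subxx in neSK.
have [sMK neMK] := andP prMK.
pose P := [pred N : {group gT} | (N <| K) && ~~ (N \subset M)].
have [|N /mingroupP[/andP[nsNK nsNM] minN] _] := @mingroup_exists _ P K.
  by rewrite /= normal_refl.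
have [sNK nNK] := andP nsNK.
have ntN: N :!=: 1 by apply: contraNneq nsNM => ->; apply: sub1G.
have sN'M: N^`(1) \subset M.
  apply: contraLR (sol_der1_proper solK sNK ntN) => nsN'M.
  by rewrite (minN _ _ (der_sub _ _)) ?properxx //= nsN'M gFnormal_trans.
have defNM: N * M = K.
  rewrite -norm_joinEr ?(subset_trans sMK) //; apply/eqP.
  have sNMK: N <*> M \subset K by rewrite join_subG sNK.
  rewrite eqEsubset sNMK; apply: contraR nsNM => nsKNM.
  by rewrite -(maxM (N <*> M)%G) ?joing_subl ?joing_subr // /proper sNMK.
have nJK: K \subset 'N(N :&: M).
  rewrite -{1}defNM mul_subG //; last by rewrite normsI ?normG ?(subset_trans sMK).
  rewrite -commg_subl (subset_trans (commSg _ (subsetIl _ _))) //.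
  by rewrite subsetI commg_subl normG; apply: sN'M.
(* If [[~ x, g]] lay in a conjugate of [S], some conjugate of it would lie in [N :&: M], which is
   normal in [K], and [[~ x, g]] would be in [M]. *)
have [/exists_inP[g Ng nMxg] | ] := boolP [exists (g | g \in N), [~ x, g] \notin M].
  have Nxg: [~ x, g] \in N.
    by rewrite commgEr groupMr // memJ_norm ?groupV // (subsetP nNK).
  exists [~ x, g]; first by right; exists g; rewrite ?(subsetP sNK).
  move=> k Kk; apply: contra nMxg; rewrite mem_conjg => Sxgk.
  have /setIP[] // : [~ x, g] \in N :&: M.
  rewrite -(memJ_norm _ (subsetP nJK _ (groupVr Kk))) inE (subsetP sSM) // andbT.
  by rewrite memJ_norm ?groupV ?(subsetP nNK).
move/exists_inPn=> cNx; exists x => [|k Kk]; first by left.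
(* Otherwise [x], hence [K], centralises [N] modulo [N :&: M], which makes [M] normal; a conjugate
   of [S] containing [x] would then put the whole class in [M]. *)
have sRJ: [~: K, N] \subset N :&: M.
  have nJx := subsetP nJK x Kx; pose J := [group of N :&: M].
  have defKJ: <<coset J x ^: (K / J)>> = K / J.
    by rewrite -quotient_class -?quotient_gen ?(subset_trans (class_subG Kx _)) ?defK.
  rewrite -(@quotient_cents2 _ _ _ J) ?(subset_trans sNK) //.
  apply: class_gen_cent defKJ _ _; first by rewrite quotient_norms.
  apply/centP=> _ /morphimP[g nJg Ng ->]; apply/commgP; rewrite -morphR //.
  apply/eqP/coset_id; rewrite inE /=; have:= cNx g Ng; rewrite negbK => ->.
  by rewrite andbT commgEr groupMr // memJ_norm ?groupV // (subsetP nNK).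
have nMK: K \subset 'N(M).
  rewrite -{1}defNM mul_subG ?normG // -commg_subl.
  rewrite (subset_trans (commSg _ sMK)) // (subset_trans sRJ) ?subsetIr //.
apply: contra neMK; rewrite mem_conjg => Sxk; rewrite -{1}defK gen_subG.
rewrite class_sub_norm // -(memJ_norm _ (subsetP nMK _ (groupVr Kk))).
by rewrite (subsetP sSM).
Qed.

End ClassGenerated.

(** * The fixed-point bound for a generating class *)

Section FixedPointBound.

Variables (gT : finGroupType) (p : nat) (V K : {group gT}).
Hypotheses (minV : minnormal V K) (pV : p.-group V) (cKV : 'C_K(V) = 1).

(** [V <*> P] is a [p]-group, so [[~: V, P]] is proper in [V], hence trivial by irreducibility;
    faithfulness then kills [P]. *)
Lemma minnormal_pcore1 (P : {group gT}) : P <| K -> p.-group P -> P :=: 1.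
Proof.
move=> nsPK pP; have [sPK nPK] := andP nsPK; apply/eqP; apply/idPn=> ntP.
have /andP[ntV nVK] := mingroupp minV; have nVP := subset_trans sPK nVK.
have pVP: p.-group (V <*> P) by rewrite norm_joinEr // pgroupM pV.
have prR: [~: V, P] \proper V.
  apply: nil_comm_properl (pgroup_nil pVP) _ ntV _; first exact: joing_subl.
  by rewrite subsetI joing_subr.
have nRK: K \subset 'N([~: V, P]) by rewrite normsR.
have [/commG1P cVP | /= RV] := minnormal_TI_or_eq minV (proper_sub prR) nRK.
  case/negP: ntV; rewrite -subG1 -(minnormal_cent_normal minV cKV nsPK ntP).
  by rewrite subsetI subxx.
by rewrite RV properxx in prR.
Qed.

Hypotheses (cVV : abelian V) (solK : solvable K).

(* Take [Q] minimal among the normal subgroups of [K] not centralised by [x]; it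
   has class at most 2, and commutators [[~ x, g]] that are not fixed by large
   subgroups of [V] are found in [Q], or from its action by permutation. *)
Lemma card_cent1_class_gen x : x \in K -> <<x ^: K>> = K -> K :!=: 1 ->
  #|'C_V[x]| ^ 4 <= #|V| ^ 3.
Proof.
move=> Kx defK ntK; have /andP[ntV nVK] := mingroupp minV.
suffices [m defm cm]: exists2 m, m = x \/ (exists2 g, g \in K & m = [~ x, g])
                               & #|'C_V[m]| ^ 2 <= #|V|.
  have expn4 k : (k ^ 4 = (k ^ 2) ^ 2)%N by rewrite -expnM.
  rewrite expn4; case: defm cm => [-> | [g Kg ->]] cm.
    apply: leq_trans (_ : #|V| ^ 2 <= _); first by rewrite leq_exp2r.
    by rewrite leq_pexp2l ?cardG_gt0.
  have := @card_cent1_commg _ V x g (subsetP nVK x Kx) (subsetP nVK g Kg).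
  rewrite -(@leq_exp2r _ _ 2) // => /leq_trans-> //.
  by rewrite expnMn [(#|V| ^ 3)%N]expnSr leq_mul.
have cent_1 m : 'C_V[m] = 1 -> #|'C_V[m]| ^ 2 <= #|V|.
  by move->; rewrite cards1 exp1n cardG_gt0.
have [cKK | ncKK] := boolP (x \in 'C(K)).
  have cKK' : K \subset 'C(K) := class_gen_cent defK (normG K) cKK.
  exists x; first by left.
  apply: cent_1; apply: minnormal_cent1 minV cKV _ _; first by rewrite inE Kx.
  by apply: contraNneq ntK => x1; rewrite -defK x1 class1G genGid.
pose P := [pred Q : {group gT} | (Q <| K) && (x \notin 'C(Q))].
have [|Q /mingroupP[/andP[nsQK ncQx] minQ] _] := @mingroup_exists _ P K.
  by rewrite /= normal_refl.
have [sQK nQK] := andP nsQK.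
have centralQ (H : {group gT}) : H <| K -> H \proper Q -> H \subset 'Z(K).
  move=> nsHK prHQ; have [sHK nHK] := andP nsHK.
  rewrite subsetI sHK centsC; apply: class_gen_cent defK nHK _.
  apply: contraLR (prHQ) => ncHx; rewrite (minQ H) ?properxx ?proper_sub //=.
  by rewrite nsHK.
have Qcomm g : g \in Q -> [~ x, g] \in Q.
  by move=> Qg; rewrite commgEr groupMr // memJ_norm ?groupV // (subsetP nQK).
have comm_wit g : g \in Q -> 'C_V[[~ x, g]] = 1 ->
    exists2 m, m = x \/ (exists2 g, g \in K & m = [~ x, g]) & #|'C_V[m]| ^ 2 <= #|V|.
  move=> Qg Cm; exists [~ x, g]; last exact: cent_1.
  by right; exists g; rewrite ?(subsetP sQK).
have [g Qg ntm]: exists2 g, g \in Q & [~ x, g] != 1.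
  move: ncQx; rewrite -sub_cent1 => /subsetPn[g Qg ncg].
  by exists g => //; apply: contra ncg => /commgP cxg; apply/cent1P.
have [cQQ | ncQQ] := boolP (abelian Q); last first.
  have sQ'Z: Q^`(1) \subset 'Z(K).
    apply: centralQ; first exact: gFnormal_trans.
    apply: sol_der1_proper solK sQK _; apply: contraNneq ncQQ => ->; exact: abelian1.
  (* A commutator [[~ x, h]] outside ['C(Q)] has a nontrivial commutator with some [k] in [Q]; being
     in ['Z(K)], that one fixes no nontrivial element of [V]. If there is no such [h], then
     [[~ x, g]] is itself in ['Z(K)]. *)
  have [/exists_inP[h Qh ncm] | ] :=
      boolP [exists (h | h \in Q), [~ x, h] \notin 'C(Q)].
    move: (ncm); rewrite -sub_cent1 => /subsetPn[k Qk nck].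
    exists [~ x, h]; first by right; exists h; rewrite ?(subsetP sQK).
    have Nq y : y \in Q -> y \in 'N(V).
      by move=> Qy; rewrite (subsetP nVK) ?(subsetP sQK).
    apply: leq_trans (card_cent1_commg (Nq _ (Qcomm h Qh)) (Nq k Qk)) _.
    rewrite (minnormal_cent1 minV cKV) ?cards1 ?muln1 //.
      by rewrite (subsetP sQ'Z) // mem_commg // Qcomm.
    by apply: contra nck => /commgP cmk; apply/cent1P.
  move/exists_inPn=> cQx; apply: (comm_wit g) => //.
  apply: minnormal_cent1 minV cKV _ ntm.
  have sZQ: 'Z(Q) \subset 'Z(K).
    apply: centralQ; first exact: gFnormal_trans.
    rewrite properE subsetIl; apply: contra ncQQ => sQZ.
    exact: subset_trans sQZ (subsetIr _ _).
  by rewrite (subsetP sZQ) // inE Qcomm //=; have:= cQx g Qg; rewrite negbK.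
have coVQ: coprime #|V| #|Q|.
  have OQ1: 'O_p(Q) = 1.
    by apply: minnormal_pcore1 (pcore_pgroup _ _); apply: gFnormal_trans.
  have:= nilpotent_pcoreC p (abelian_nil cQQ); rewrite OQ1 dprod1g => <-.
  exact: pnat_coprime pV (pcore_pgroup _ _).
(* If nontrivial elements of [Q] act without fixed points, [[~ x, g]] serves. Otherwise a maximal
   [R] with fixed points is not normal in [K], and an [n] outside all conjugates of its normaliser
   moves every conjugate of [R]. *)
have [/exists_inP[m Qm /andP[ntm' ntCm]] | ] :=
    boolP [exists (m | m \in Q), (m != 1) && ('C_V[m] != 1)]; last first.
  move/exists_inPn=> regQ; apply: (comm_wit g) => //.
  by have:= regQ _ (Qcomm g Qg); rewrite ntm negbK => /eqP.
pose PR := [pred R : {group gT} | (R \subset Q) && ('C_V(R) != 1)].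
have [|R /maxgroupP[/andP[sRQ ntCR] maxR] smR] := @maxgroup_exists _ PR <[m]>%G.
  by rewrite /= cycle_subG Qm cent_cycle.
have ntR: R :!=: 1.
  by apply: contraNneq ntm' => R1; rewrite -cycle_eq1 -subG1 -R1.
have prS: 'N_K(R) \proper K.
  rewrite properE subsetIl; apply: contra ntCR => sKN; apply/eqP.
  apply: (minnormal_cent_normal minV cKV) ntR.
  by rewrite /normal (subset_trans sRQ) // (subset_trans sKN) ?subsetIr.
have [n defn movesn] := class_gen_moves solK Kx defK prS.
exists n => //; have Kn: n \in K.
  by case: defn => [-> | [h Kh ->]] //; rewrite groupR.
apply: (card_cent1_imprimitive minV cVV coVQ cQQ nQK sQK sRQ ntCR) => //.
  by move=> R' sR'Q ntCR' sRR'; rewrite (maxR R') //= sR'Q.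
move=> k Kk; apply: contra (movesn k Kk); rewrite normJ conjIg inE => ->.
by rewrite conjGid ?Kn.
Qed.

End FixedPointBound.

(** * Five generators *)

(** Tuples are finite functions, so that they can be counted and existence over them is
    decidable. *)
Definition span (gT : finGroupType) n (f : {ffun 'I_n -> gT}) : {group gT} :=
  <<[set f j | j : 'I_n]>>%G.

Section Span.

Variables (gT : finGroupType) (n : nat).
Implicit Types (G H K M N U V W : {group gT}) (f : {ffun 'I_n -> gT}).

Lemma mem_span f j : f j \in span f.
Proof. by rewrite mem_gen // imset_f. Qed.

Lemma span_subG f G : (forall j, f j \in G) -> span f \subset G.
Proof. by move=> Gf; rewrite gen_subG; apply/subsetP=> _ /imsetP[j _ ->]. Qed.

Lemma span_quotient f U : (forall j, f j \in 'N(U)) ->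
  span f / U = span [ffun j => coset U (f j)].
Proof.
move=> nUf; rewrite quotient_gen; last by apply/subsetP=> _ /imsetP[j _ ->].
congr <<_>>; apply/setP=> y.
apply/morphimP/imsetP=> [[_ _ /imsetP[j _ ->] ->] | [j _ ->]].
  by exists j; rewrite ?ffunE.
by exists (f j); rewrite ?imset_f ?ffunE.
Qed.

Lemma span_lift (S : {set gT}) U (g : {ffun 'I_n -> coset_of U}) :
    (forall j, g j \in S / U) ->
  exists2 f : {ffun 'I_n -> gT}, (forall j, f j \in S) & span f / U = span g.
Proof.
move=> Sg; have lift j : {s | s \in 'N(U) & (s \in S) && (coset U s == g j)}.
  apply: sig2W; have /morphimP[s nUs Ss defg] := Sg j.
  by exists s; rewrite ?Ss ?defg /=.
exists [ffun j => s2val (lift j)] => [j|].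
  by rewrite ffunE; case: (lift j) => s _ /= /andP[].
rewrite span_quotient => [|j]; last by rewrite ffunE; case: (lift j).
congr <<_>>; apply: eq_imset => j.
by rewrite !ffunE; case: (lift j) => s _ /= /andP[_ /eqP].
Qed.

Lemma span_lift_nilser (S : {set gT}) H U i (g : {ffun 'I_n -> coset_of U}) :
    S \subset H -> H \subset 'N(U) -> (forall j, g j \in S / U) ->
    nilser i (span g) :!=: 1 ->
  exists2 f : {ffun 'I_n -> gT},
    (forall j, f j \in S) & ~~ (nilser i (span f) \subset U).
Proof.
move=> sSH nUH Sg; have [f Sf defg] := span_lift Sg.
have nUf: span f \subset 'N(U).
  by apply: span_subG => j; rewrite (subsetP nUH) ?(subsetP sSH).
move=> ntg; exists f => //; apply: contra ntg.
rewrite -quotient_sub1 ?(subset_trans (nilser_sub _ _)) // quotient_nilser // subG1.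
move/eqP=> /= ng1; rewrite -subG1 -ng1 nilserS //= defg //.
Qed.

End Span.

(** Take [N] maximal among the normal subgroups with [nilser i N] a [pi]-group. As [nilser i]
    respects joins of normal subgroups, any [x] of [S] outside [N] serves. *)
Lemma class_gen_not_pgroup (gT : finGroupType) (pi : nat_pred) i
    (H : {group gT}) (S : {set gT}) :
    <<S>> = H -> H \subset 'N(S) -> ~~ pi.-group (nilser i H) ->
  exists2 x, x \in S & ~~ pi.-group (nilser i <<x ^: H>>%G).
Proof.
move=> defH nSH ntH.
pose P := [pred N : {group gT} | (N <| H) && pi.-group (nilser i N)].
have [|N /maxgroupP[/andP[nsNH piN] maxN] _] := @maxgroup_exists _ P 1%G.
  by rewrite /= normal1 (pgroupS (nilser_sub _ _)) ?pgroup1.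
have [x Sx nNx]: exists2 x, x \in S & x \notin N.
  apply/subsetPn; apply: contra ntH => sSN; rewrite (pgroupS _ piN) // nilserS //.
  by rewrite -defH gen_subG.
exists x => //; apply: contra nNx => piM; set M := <<_>>%G in piM.
have Hx: x \in H by rewrite -defH mem_gen.
have nsMH: M <| H by rewrite /normal gen_subG class_subG // norms_gen ?class_norm.
rewrite -(maxN (N <*> M)%G) ?joing_subl //=.
  by rewrite (subsetP (joing_subr _ _)) // mem_gen ?class_refl.
rewrite normalY // (nilser_mul i nsNH nsMH) norm_joinEr ?pgroupM ?piN //.
rewrite (subset_trans (nilser_sub _ _)) ?(subset_trans (normal_sub nsMH)) //.
by rewrite (char_norm_trans (nilser_char _ _)) ?normal_norm.
Qed.

(** * Counting the lifts of a complement *)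

Section ComplementCount.

Variables (gT : finGroupType) (p i n : nat) (V K : {group gT}).
Variable f : {ffun 'I_n -> gT}.
Hypotheses (nVK : K \subset 'N(V)) (pV : p.-group V) (cVV : abelian V).
Hypothesis tiKV : K :&: V = 1.
Hypotheses (p'L : p^'.-group (nilser i K)) (cVL : 'C_V(nilser i K) = 1).
Hypothesis defK : span f = K :> {set gT}.
Hypothesis complement : forall g : {ffun 'I_n -> gT},
  (forall j, g j \in f j ^: V) -> span g :&: V = 1.

(** By Schur-Zassenhaus some [w] in [V] conjugates [nilser i K] to [nilser i (span g)]. The
    normaliser of [nilser i K] in [K * V] lies in [K], so [span g] lies in [K :^ w], where [g j] and
    [f j ^ w] agree modulo [V]. *)
Lemma lift_conj (g : {ffun 'I_n -> gT}) : (forall j, g j \in f j ^: V) ->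
  exists2 w, w \in V & forall j, g j = f j ^ w.
Proof.
move=> gP; have tig := complement gP; pose L := nilser i K.
have Kf j : f j \in K by rewrite -defK mem_span.
have nVf j : f j \in 'N(V) := subsetP nVK _ (Kf j).
have [v Vv gE]: exists2 v : 'I_n -> gT, forall j, v j \in V & forall j, g j = f j ^ v j.
  have w_ j : {w | w \in V & g j == f j ^ w}.
    by apply: sig2W; have /imsetP[w Vw ->] := gP j; exists w.
  by exists (fun j => s2val (w_ j)) => j; case: (w_ j) => w Vw /= /eqP.
have nVv j : v j \in 'N(V) by rewrite (subsetP (normG V)).
have nVg: span g \subset 'N(V).
  by apply: span_subG => j; rewrite gE groupJ.
have quo_g: span g / V = K / V.
  rewrite -defK !span_quotient // => [|j]; last first.
    by rewrite gE groupJ.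
  congr <<_>>; apply: eq_imset => j; rewrite !ffunE gE morphJ //=.
  by rewrite (coset_id (Vv j)) conjg1.
have nVL: L \subset 'N(V) := subset_trans (nilser_sub _ _) nVK.
have nVLg: nilser i (span g) \subset 'N(V) := subset_trans (nilser_sub _ _) nVg.
have quo_L: nilser i (span g) / V = L / V.
  rewrite !quotient_nilser //; congr (gval (nilser i _)); exact/val_inj.
have cardL: #|nilser i (span g)| = #|L|.
  have card_quo (A : {group gT}) : A \subset 'N(V) -> A :&: V = 1 -> #|A / V| = #|A|.
    by move=> nVA tiA; apply/esym/card_isog/quotient_isog; rewrite // setIC.
  rewrite -(card_quo L) //; last by apply/trivgP; rewrite -tiKV setSI ?nilser_sub.
  rewrite -quo_L card_quo //.
  by apply/trivgP; rewrite -tig setSI ?nilser_sub.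
have coVL: coprime #|V| #|L| by apply: pnat_coprime pV p'L.
have [|w Vw defLg] := SchurZassenhaus_trans_sol (abelian_sol cVV) nVL _ coVL cardL.
  by rewrite -quotientSK // quo_L.
exists w => // j.
have sNK: 'N_(K * V)(L) \subset K.
  rewrite -group_modl ?nilser_norm // mul_subG //.
  apply: subset_trans (sub1G K); rewrite -cVL subsetI subsetIl /=.
  apply/commG1P/trivgP; rewrite -(coprime_TIg coVL) subsetI commg_subr subsetIr andbT.
  by rewrite (subset_trans (commSg _ (subsetIl _ _))) // commg_subl.
have sgKw: span g \subset K :^ w.
  rewrite -sub_conjgV (subset_trans _ sNK) // subsetI; apply/andP; split.
    rewrite sub_conjgV -norm_joinEl // conjGid ?(subsetP (joing_subr K V)) //.
    apply: span_subG => k; rewrite gE groupJ //.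
      by rewrite (subsetP (joing_subl K V)).
    by rewrite (subsetP (joing_subr K V)).
  by rewrite sub_conjgV -normJ -defLg nilser_norm.
apply/eqP; rewrite eq_mulgV1 -in_set1 -[[set 1]](conjs1g w) -tiKV.
rewrite conjIg (conjGid Vw) inE.
rewrite groupM ?groupV ?memJ_conjg ?Kf ?(subsetP sgKw) ?mem_span //=.
have nVw: w \in 'N(V) by rewrite (subsetP (normG V)).
have nVfv: f j ^ v j \in 'N(V) by rewrite groupJ.
have nVfw: f j ^ w \in 'N(V) by rewrite groupJ.
apply: coset_idr; first by rewrite gE groupM ?groupV.
rewrite gE morphM ?groupV // morphV // !morphJ //= (coset_id (Vv j)) (coset_id Vw).
by rewrite !conjg1 mulgV.
Qed.

(** Each [f j] has as many lifts as the index of ['C_V[f j]] in [V], while by [lift_conj] a tuple of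
    lifts is determined by one element of [V]. *)
Lemma card_lifts : #|V| ^ n <= #|V| * \prod_(j < n) #|'C_V[f j]|.
Proof.
pose F (j : 'I_n) := [pred y | y \in f j ^: V].
have cardF: #|family F| <= #|V|.
  pose h w := [ffun j => f j ^ w] : {ffun 'I_n -> gT}.
  apply: leq_trans (leq_imset_card h V); rewrite subset_leq_card //.
  apply/subsetP=> g /familyP gP; have [w Vw gE] := lift_conj gP.
  by apply/imsetP; exists w => //; apply/ffunP=> j; rewrite ffunE gE.
apply: leq_trans (leq_mul cardF (leqnn _)).
rewrite card_family foldrE big_map big_enum /= -big_split /=.
rewrite -{1}(card_ord n) -prod_nat_const; apply: leq_prod => j _.
rewrite [X in _ <= X * _](@eq_card _ _ (f j ^: V)) //.
by rewrite -index_cent1 mulnC Lagrange ?subsetIl.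
Qed.

End ComplementCount.

Lemma solvable_not_pgroup (gT : finGroupType) p (G : {group gT}) :
    solvable G -> ~~ p.-group G ->
  exists Y : {group gT}, [/\ Y \subset G, p^'.-group Y & Y :!=: 1].
Proof.
move=> solG not_pG; have [Y hallY] := Hall_exists p^' solG.
exists Y; rewrite (pHall_sub hallY) (pHall_pgroup hallY); split=> //.
apply: contraNneq not_pG => Y1; have := card_Hall hallY.
by rewrite Y1 cards1 /pgroup => /esym/eqP; rewrite partn_eq1 // pnatNK.
Qed.

(** * The minimal counterexample to five generators *)

Section FiveGenerators.

Variables (gT : finGroupType) (i : nat) (H : {group gT}) (S : {set gT}).
Hypotheses (solH : solvable H) (defH : <<S>> = H) (nSH : H \subset 'N(S)).
Hypothesis ntVi : nilser i.+1 H :!=: 1.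
Hypothesis IHi : forall (rT : finGroupType) (G : {group rT}) (T : {set rT}),
  solvable G -> <<T>> = G -> G \subset 'N(T) -> nilser i G :!=: 1 ->
  exists2 f : {ffun 'I_5 -> rT}, forall j, f j \in T & nilser i (span f) :!=: 1.
Hypothesis IHH : forall (rT : finGroupType) (G : {group rT}) (T : {set rT}),
  #|G| < #|H| ->
  solvable G -> <<T>> = G -> G \subset 'N(T) -> nilser i.+1 G :!=: 1 ->
  exists2 f : {ffun 'I_5 -> rT}, forall j, f j \in T & nilser i.+1 (span f) :!=: 1.

Hypothesis bad : ~ exists2 f : {ffun 'I_5 -> gT},
  forall j, f j \in S & nilser i.+1 (span f) :!=: 1.

Let V : {group gT} := nilser i.+1 H.
Let L : {group gT} := nilser i H.

Let sSH : S \subset H. Proof. by rewrite -defH subset_gen. Qed.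

Let sub_eq (X : {group gT}) (T : {set gT}) :
    X \subset H -> <<T>> = X -> X \subset 'N(T) -> T \subset S ->
    nilser i.+1 X :!=: 1 ->
  X :=: H.
Proof.
move=> sXH defX nTX sTS ntX; apply/eqP; apply/idPn=> neXH; case: bad.
have [|f Tf ntf] := IHH _ (solvableS sXH solH) defX nTX ntX.
  by rewrite proper_card // properEneq neXH.
by exists f => // j; rewrite (subsetP sTS).
Qed.

(** Otherwise [nilser i.+1 (H / U)] is nontrivial, and the five elements that induction on the order
    finds in [H / U] lift to [S]. *)
Lemma minimal_sub (U : {group gT}) : U <| H -> U :!=: 1 -> V \subset U.
Proof.
move=> nsUH ntU; have [sUH nUH] := andP nsUH; apply/idPn=> nsVU; case: bad.
have [|||||f Sf ntf] := @IHH _ (H / U)%G (S / U).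
- by rewrite ltn_quotient.
- exact: quotient_sol.
- by rewrite /= -quotient_gen ?defH // (subset_trans sSH).
- by rewrite quotient_norms.
- rewrite -quotient_nilser // -subG1 quotient_sub1 //.
  exact: subset_trans (nilser_sub _ _) nUH.
have [g Sg ntg] := span_lift_nilser sSH nUH Sf ntf.
by exists g => //; apply: contraNneq ntg => ->; apply: sub1G.
Qed.

Let p := pdiv #|V|.

Let sVH : V \subset H := nilser_sub _ _.
Let nsVH : V <| H := char_normal (nilser_char _ _).
Let nsLH : L <| H := char_normal (nilser_char _ _).
Let sVL : V \subset L := nilser_decr _ (leqnSn i).

Lemma minnormalV : minnormal V H.
Proof.
apply/mingroupP; split=> [|U /andP[ntU nUH] sUV]; first by rewrite ntVi normal_norm.
apply/eqP; rewrite eqEsubset sUV minimal_sub //.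
by rewrite /normal (subset_trans sUV).
Qed.

Lemma abelemV : p.-abelem V.
Proof. by have [] := minnormal_solvable minnormalV sVH solH. Qed.

Let pV : p.-group V := abelem_pgroup abelemV.
Let cVV : abelian V := abelem_abelian abelemV.

Lemma not_pgroup_L : ~~ p.-group L.
Proof. by apply: contra ntVi => /pgroup_nil; rewrite -nilres_eq1. Qed.

Lemma nilpotent_quo_L (A : {group gT}) : A \subset L -> nilpotent (A / V).
Proof.
move=> sAL; apply: nilpotentS (quotientS _ sAL) _.
by rewrite -nilres_sub_quo // (subset_trans (normal_sub nsLH)) ?normal_norm.
Qed.

Lemma pcore_L_Hall : p.-Hall(L) 'O_p(L).
Proof.
have nsVL: V <| L := normalS sVL (normal_sub nsLH) nsVH.
have nsVO: V <| 'O_p(L).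
  exact: (normalS (pcore_max pV nsVL) (pcore_sub p L) nsVL).
rewrite -(pquotient_pHall pV nsVL nsVO) -pquotient_pcore //.
exact: nilpotent_pcore_Hall (nilpotent_quo_L (subxx L)).
Qed.

(** The residual of ['C_L(V)] lies in [V], hence is central, so ['C_L(V)] is nilpotent. If its
    [p']-core were nontrivial, it would contain the [p]-group [V]. *)
Lemma pgroup_cent_L : p.-group 'C_L(V).
Proof.
have nsCH: 'C_L(V) <| H.
  apply/andP; split; first exact: subset_trans (subsetIl _ _) (normal_sub nsLH).
  by apply: normsI; rewrite ?norms_cent ?normal_norm.
have sCL: 'C_L(V) \subset L := subsetIl _ _; pose C := 'C_L(V)%G.
have sRV: nilres C \subset V.
  rewrite nilres_sub_quo ?nilpotent_quo_L //.
  by rewrite (subset_trans (normal_sub nsCH)) ?normal_norm.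
have nilC: nilpotent C.
  rewrite -nilres_eq1 -nilres_comm -subG1 (subset_trans (commSg _ sRV)) //.
  by apply/trivgP/commG1P; rewrite centsC; exact: subsetIr.
have [O1 | ntO] := eqVneq 'O_p^'(C) 1.
  by have:= nilpotent_pcoreC p nilC; rewrite O1 dprodg1 => <-; apply: pcore_pgroup.
have sVO: V \subset 'O_p^'(C) by apply: minimal_sub => //; apply: gFnormal_trans.
have coVV: coprime #|V| #|V| := pnat_coprime pV (pgroupS sVO (pcore_pgroup _ _)).
by case/eqP: ntVi; rewrite -[LHS]setIid; apply: coprime_TIg coVV.
Qed.

(* The witness is a minimal [K = <<S :&: K>>] with [nilser i K] not a [p]-group;
   the induction hypothesis applied to [K / 'O_p(K)] makes it 5-generated. *)
Lemma exists_complement_gen : exists x : gT, exists f : {ffun 'I_5 -> gT},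
  [/\ x ^: H \subset S, <<x ^: span f>> = span f, span f \subset H,
      forall j, f j \in x ^: span f & ~~ p.-group (nilser i (span f))].
Proof.
pose P := [pred K : {group gT} | (<<S :&: K>> == K) && ~~ p.-group (nilser i K)].
have [|K /mingroupP[/andP[/eqP defK not_pK] minK] sKH] := @mingroup_exists _ P H.
  by rewrite /= (setIidPl sSH) defH eqxx not_pgroup_L.
have nSK: K \subset 'N(S :&: K) by rewrite normsI ?normG // (subset_trans sKH).
have genP (T : {set gT}) (M : {group gT}) :
    <<T>> = M -> T \subset S -> M \subset K -> ~~ p.-group (nilser i M) -> M :=: K.
  move=> defM sTS sMK not_pM; apply: minK => //; rewrite /= not_pM andbT.
  rewrite eqEsubset gen_subG subsetIr -{1}defM genS // subsetI sTS -defM.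
  exact: subset_gen.
have [x /setIP[Sx Kx] not_px] := class_gen_not_pgroup defK nSK not_pK.
have sxS: x ^: K \subset S by rewrite class_sub_norm // (subset_trans sKH).
have defKx: <<x ^: K>> = K.
  by apply: (genP (x ^: K) <<x ^: K>>%G); rewrite ?gen_subG ?class_subG.
have nOK: K \subset 'N('O_p(K)) := gFnorm _ _.
have [||||f xf ntf] := IHi (G := (K / 'O_p(K))%G) (T := x ^: K / 'O_p(K)).
- by rewrite quotient_sol // (solvableS sKH).
- by rewrite /= -quotient_gen ?defKx // (subset_trans (class_subG Kx _)).
- by rewrite quotient_norms ?class_norm.
- rewrite -quotient_nilser // -subG1 quotient_sub1.
    by apply: contra not_pK => sLO; apply: pgroupS sLO (pcore_pgroup _ _).
  exact: subset_trans (nilser_sub _ _) nOK.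
have [g xg nsgO] := span_lift_nilser (class_subG Kx (subxx K)) nOK xf ntf.
have sgK: span g \subset K.
  by apply: span_subG => j; rewrite (subsetP (class_subG Kx (subxx K))).
have defg: span g :=: K.
  apply: (genP [set g j | j : 'I_5]) => //.
    by apply/subsetP=> _ /imsetP[j _ ->]; rewrite (subsetP sxS).
  (* A [p]-group [nilser i (span g)] would lie in ['O_p(L) :&: K], a normal [p]-subgroup of [K],
     hence in ['O_p(K)]. *)
  apply: contra nsgO => pg; apply: subset_trans (_ : 'O_p(L) :&: K \subset _).
    rewrite subsetI; apply/andP; split; last exact: subset_trans (nilser_sub _ _) sgK.
    rewrite (sub_normal_Hall pcore_L_Hall) ?pcore_normal ?nilserS //.
    exact: subset_trans sgK sKH.
  apply: pcore_max; first by rewrite (pgroupS (subsetIl _ _)) ?pcore_pgroup.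
  rewrite /normal subsetIr normsI ?normG // (subset_trans sKH) //.
  by rewrite gFnorm_trans // normal_norm.
have eqgK : span g = K by apply/val_inj.
by exists x, g; rewrite eqgK class_sub_norm.
Qed.

Lemma five_generators_step : False.
Proof.
have [x [f []]] := exists_complement_gen; pose K := span f.
rewrite -/K => sxHS defK sKH xf not_pK.
have Sf j : f j \in S by apply: subsetP (subset_trans (imsetS _ sKH) sxHS) _ (xf j).
have Kx : x \in K by rewrite -defK mem_gen ?class_refl.
have nVH : H \subset 'N(V) := normal_norm nsVH.
have nVK : K \subset 'N(V) := subset_trans sKH nVH.
have sLKL : nilser i K \subset L := nilserS i sKH.
have solLK := solvableS (subset_trans (nilser_sub i K) sKH) solH.
have [Y [sYLK p'Y ntY]] := solvable_not_pgroup solLK not_pK.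
have sYL := subset_trans sYLK sLKL.
have ncVY: ~~ (Y \subset 'C(V)).
  apply: contra ntY => cVY; have pY: p.-group Y.
    by apply: pgroupS pgroup_cent_L; rewrite subsetI sYL.
  by rewrite -subG1 -(coprime_TIg (pnat_coprime pY p'Y)) subsetI subxx.
have nVY : Y \subset 'N(V).
  by rewrite (subset_trans sYLK) // (subset_trans (nilser_sub _ _)).
have coVY : coprime #|V| #|Y| := pnat_coprime pV p'Y.
(* Let the class of [x] under [K <*> V] generate [X]. Were [nilser i X] nilpotent, its subgroups [Y]
   and [[~: V, Y]] of coprime orders would commute, and [Y] would centralise [V]. *)
have defH' : K <*> V = H.
  pose X := <<x ^: (K <*> V)>>%G.
  have sKVH : K <*> V \subset H by rewrite join_subG sKH.
  have sXKV : X \subset K <*> V.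
    by rewrite gen_subG class_subG // (subsetP (joing_subl _ _)).
  have nXKV : K <*> V \subset 'N(X) by rewrite norms_gen ?class_norm.
  have sKX : K \subset X.
    by rewrite -{1}defK genS // imsetS // joing_subl.
  suffices XH : X :=: H by apply/eqP; rewrite eqEsubset sKVH -{1}XH.
  apply: (sub_eq (subset_trans sXKV sKVH) (erefl _)).
  - exact: subset_trans sXKV (class_norm _ _).
  - exact: subset_trans (imsetS _ sKVH) sxHS.
  rewrite /= nilres_eq1; apply: contra ncVY => nilX.
  have sYX : Y \subset nilser i X := subset_trans sYLK (nilserS i sKX).
  have sRX : [~: V, Y] \subset nilser i X.
    rewrite (subset_trans (commgS _ sYX)) // commg_subr.
    rewrite (char_norm_trans (nilser_char _ _)) // (subset_trans _ nXKV) //.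
    exact: joing_subr.
  have sRV : [~: V, Y] \subset V by rewrite commg_subl.
  have cRY : [~: V, Y] \subset 'C(Y).
    rewrite (sub_nilpotent_cent2 nilX) // coprime_sym.
    exact: coprimeSg sRV coVY.
  apply/commG1P/trivgP; rewrite /= commGC -(coprime_abel_cent_TI nVY coVY cVV).
  by rewrite subsetI subxx.
have minVK : minnormal V K.
  apply/mingroupP; split=> [|U /andP[ntU nUK] sUV]; first by rewrite ntVi.
  have [_ minV] := mingroupP minnormalV; apply: minV => //; rewrite ntU.
  by rewrite -defH' join_subG nUK cents_norm // (centsS sUV).
(* The intersection is normal in [H], so if nontrivial it contains [V]; then [span g = H], against
   [bad]. *)
have tiV (g : {ffun 'I_5 -> gT}) :
    (forall j, g j \in S) -> span g <*> V = H -> span g :&: V = 1.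
  move=> Sg genH; have sgH : span g \subset H by rewrite -genH joing_subl.
  have [// | ntU] := eqVneq (span g :&: V) 1.
  have sVU: V \subset span g :&: V.
    apply: minimal_sub ntU; rewrite /normal (subset_trans (subsetIr _ _)) //=.
    rewrite -{1}genH join_subG normsI ?normG ?(subset_trans sgH) //=.
    by rewrite cents_norm // (centsS (subsetIr _ _)).
  have eqgH : span g = H.
    apply/val_inj; rewrite /= -genH; apply/esym/joing_idPl.
    exact: subset_trans sVU (subsetIl _ _).
  by case: bad; exists g; rewrite ?eqgH.
have tiKV : K :&: V = 1 by apply: tiV.
have cKV : 'C_K(V) = 1.
  have [// | ntU] := eqVneq 'C_K(V) 1.
  have sVU: V \subset 'C_K(V).
    apply: minimal_sub ntU; rewrite /normal (subset_trans (subsetIl _ _)) //=.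
    rewrite -{1}defH' join_subG normsI ?normG ?norms_cent //=.
    by rewrite cents_norm // centsC subsetIr.
  case/negP: ntVi; rewrite -subG1 -tiKV subsetI subxx andbT.
  exact: subset_trans sVU (subsetIl _ _).
have nsLK : nilser i K <| K := char_normal (nilser_char _ _).
have p'L : p^'.-group (nilser i K).
  have OL1 : 'O_p(nilser i K) = 1.
    apply: (minnormal_pcore1 minVK pV cKV); last exact: pcore_pgroup.
    exact: char_normal_trans (pcore_char _ _) nsLK.
  have nilL : nilpotent (nilser i K).
    rewrite -nilres_eq1 -subG1 -tiKV subsetI (subset_trans (nilser_sub i.+1 K)) //.
    rewrite nilres_sub_quo ?nilpotent_quo_L //.
    exact: subset_trans (normal_sub nsLK) nVK.
  have:= nilpotent_pcoreC p nilL; rewrite OL1 dprod1g => <-; exact: pcore_pgroup.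
have cVL : 'C_V(nilser i K) = 1.
  apply: minnormal_cent_normal minVK cKV nsLK _.
  by apply: contraNneq not_pK => ->; apply: pgroup1.
have fV_S (g : {ffun 'I_5 -> gT}) : (forall j, g j \in f j ^: V) -> forall j, g j \in S.
  move=> gP j; have /imsetP[v Vv ->] := gP j.
  by rewrite memJ_norm // (subsetP nSH) // (subsetP sVH).
have lift_gen (g : {ffun 'I_5 -> gT}) :
    (forall j, g j \in f j ^: V) -> span g <*> V = H.
  move=> gP; apply/eqP; rewrite eqEsubset join_subG sVH span_subG /=; last first.
    by move=> j; rewrite (subsetP sSH) ?fV_S.
  rewrite -defH' join_subG joing_subr andbT; apply: span_subG => j.
  have /imsetP[v Vv gj] := gP j; rewrite -(conjgK v (f j)) -gj groupJ //.
    by rewrite (subsetP (joing_subl _ _)) ?mem_span.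
  by rewrite groupV (subsetP (joing_subr _ _)).
have le_lifts := card_lifts nVK pV cVV tiKV p'L cVL (erefl _)
                   (fun g gP => tiV g (fV_S g gP) (lift_gen g gP)).
have cf j : #|'C_V[f j]| = #|'C_V[x]|.
  have /imsetP[k Kk ->] := xf j.
  by rewrite cent1J -{1}(normsP nVK k Kk) -conjIg cardJg.
have ntK : K :!=: 1.
  by apply: contraNneq not_pK => K1; rewrite (pgroupS (nilser_sub _ _)) // K1 pgroup1.
have := card_cent1_class_gen minVK pV cKV cVV (solvableS sKH solH) Kx defK ntK.
move: le_lifts; rewrite (eq_bigr _ (fun j _ => cf j)) prod_nat_const card_ord.
set c := #|'C_V[x]|; have v_gt1 : 1 < #|V| by rewrite cardG_gt1.
rewrite expnS leq_pmul2l ?cardG_gt0 // => le1 le2.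
(* With [v = #|V|], the count [v^4 <= c^5] and the bound [c^4 <= v^3] give [v^16 <= v^15]. Five is
   the least number of generators for which the two conflict. *)
have : (#|V| ^ 4) ^ 4 <= (#|V| ^ 3) ^ 5.
  apply: leq_trans (_ : (c ^ 5) ^ 4 <= _); first by rewrite leq_exp2r.
  by rewrite -expnM mulnC expnM leq_exp2r.
by rewrite -!expnM leq_exp2l.
Qed.

End FiveGenerators.

(** Outer induction on [i], inner induction on the order of [H]. For [i = 0] a nontrivial element of
    [S], repeated, suffices. *)
Theorem five_generators (gT : finGroupType) i (H : {group gT}) (S : {set gT}) :
    solvable H -> <<S>> = H -> H \subset 'N(S) -> nilser i H :!=: 1 ->
  exists2 f : {ffun 'I_5 -> gT}, forall j, f j \in S & nilser i (span f) :!=: 1.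
Proof.
elim: i => [|i IHi] in gT H S *.
  move=> _ defH _ ntH; have [s Ss nts] : exists2 s, s \in S & s \notin [1 gT].
    by apply/subsetPn; rewrite -gen_subG defH subG1.
  exists [ffun=> s] => [j|]; first by rewrite ffunE.
  apply: contraNneq nts => /= D1; rewrite -D1.
  by have:= mem_span [ffun=> s] (ord0 : 'I_5); rewrite ffunE.
have [m] := ubnP #|H|; elim: m => // m IHm in gT H S *.
move=> /ltnSE-leHm solH defH nSH ntVi.
pose good (f : {ffun 'I_5 -> gT}) :=
  [forall j, f j \in S] && (nilser i.+1 (span f) != 1 :> {set gT}).
have [/existsP[f /andP[/forallP Sf ntf]] | no_f] := boolP [exists f, good f].
  by exists f.
case: (@five_generators_step gT i H S) => //.
  by move=> rT G T ltGH; apply: IHm; apply: leq_trans ltGH leHm.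
case=> f Sf ntf; case/existsP: no_f; exists f.
by rewrite /good ntf andbT; apply/forallP.
Qed.

(** * Seven elements *)

(** The first five entries keep the height maximal; the last two make room for the conjugates that
    express [u ^ g]. *)
Definition append2 (T : Type) (f : {ffun 'I_5 -> T}) (a b : T) : {ffun 'I_7 -> T} :=
  [ffun j : 'I_7 => if j < 5 then f (inord j) else if j == 5 :> nat then a else b].

Section SolvableSevenfold.

Variables (gT : finGroupType) (G : {group gT}) (x : gT).
Hypothesis Gx : x \in G.
Hypothesis sol7 : forall f : {ffun 'I_7 -> gT},
  (forall j, f j \in x ^: G) -> solvable (span f).

Let C := x ^: G.
Let sCG : C \subset G. Proof. exact: class_subG. Qed.

Lemma append2P (f : {ffun 'I_5 -> gT}) a b :
    (forall j, f j \in C) -> a \in C -> b \in C ->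
  [/\ forall j, append2 f a b j \in C, span f \subset span (append2 f a b),
      a \in span (append2 f a b) & b \in span (append2 f a b)].
Proof.
move=> Cf Ca Cb; split=> [j||| ].
- by rewrite ffunE; case: ifP => // _; case: ifP.
- apply: span_subG => j; have := mem_span (append2 f a b) (inord j).
  have lt7 : j < 7 by apply: leq_trans (ltn_ord j) _.
  by rewrite ffunE inordK // ltn_ord inord_val.
- by have := mem_span (append2 f a b) (inord 5); rewrite ffunE inordK.
by have := mem_span (append2 f a b) (inord 6); rewrite ffunE inordK.
Qed.

Hypothesis ntx : x != 1.

Let Cx : x \in C. Proof. exact: class_refl. Qed.

Lemma mem_span_const : x \in span ([ffun=> x] : {ffun 'I_5 -> gT}).
Proof. by have := mem_span [ffun=> x] (ord0 : 'I_5); rewrite ffunE. Qed.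

(** If seven members of [C] reached height [h.+1], the key fact would extract five members that do,
    against maximality of [h]. *)
Lemma exists_max_height : exists2 h,
    exists2 f : {ffun 'I_5 -> gT}, forall j, f j \in C & nilser h (span f) :!=: 1
  & forall f : {ffun 'I_7 -> gT}, (forall j, f j \in C) -> nilser h.+1 (span f) :=: 1.
Proof.
pose good h (f : {ffun 'I_5 -> gT}) :=
  [forall j, f j \in C] && (nilser h (span f) != 1 :> {set gT}).
pose P h := [exists f, good h f].
have P0 : exists h, P h.
  exists 0; apply/existsP; exists [ffun=> x]; apply/andP; split.
    by apply/forallP=> j; rewrite ffunE.
  by apply: contraNneq ntx => /= D1; rewrite -in_set1 -[[set 1]]D1 mem_span_const.
have leP h : P h -> h <= #|gT|.
  case/existsP=> f /andP[/forallP Cf]; apply: contraR; rewrite -ltnNge => lt_gT_h.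
  have [CF sfF _ _] := append2P Cf Cx Cx; apply/eqP.
  apply: nilser_sol_eq1; first exact: solvableS sfF (sol7 CF).
  exact: leq_trans (max_card _) (ltnW lt_gT_h).
have [h /existsP[f /andP[/forallP Cf ntf]] maxh] := ex_maxnP P0 leP.
exists h => [|g Cg]; first by exists f.
apply/eqP; apply: contraFT (ltnn h) => ntg; apply: maxh.
have sgG : span g \subset G by apply: span_subG => j; rewrite (subsetP sCG).
have [||k Sk ntk] := five_generators (S := span g :&: C) (sol7 Cg) _ _ ntg.
- apply/eqP; rewrite eqEsubset gen_subG subsetIl gen_subG.
  apply/subsetP=> _ /imsetP[j _ ->]; rewrite mem_gen // inE Cg mem_span //.
- by rewrite normsI ?normG ?(subset_trans sgG) ?class_norm.
apply/existsP; exists k; rewrite /good ntk andbT; apply/forallP=> j.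
by have /setIP[] := Sk j.
Qed.

Lemma exists_sub_pelt : exists (p : nat) u h, [/\ u \in G, u != 1, p.-elt u
  & forall g, g \in G -> exists T : {group gT},
      [/\ nilpotent (nilser h T), u \in nilser h T & u ^ g \in T]].
Proof.
have [[|h] [f Cf ntf] top1] := exists_max_height.
  have [p p_pr p_x] : exists2 p, prime p & p %| #[x].
    by exists (pdiv #[x]); rewrite ?pdiv_dvd ?pdiv_prime // order_gt1.
  have Xu y : x.`_p ^ y \in <[x ^ y]> by rewrite -consttJ mem_cycle.
  exists p, x.`_p, 0; split; rewrite ?groupX ?p_elt_constt //.
    apply: contraL p_x => /eqP/constt1P; rewrite /p_elt => p'x.
    by rewrite -p'natE.
  move=> g Gg; have Cg : x ^ g \in C by apply: imset_f.
  have Cc j : ([ffun=> x] : {ffun 'I_5 -> gT}) j \in C by rewrite ffunE.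
  have [CF sxF Fg _] := append2P Cc Cg Cg.
  exists (span (append2 [ffun=> x] (x ^ g) (x ^ g))).
  have Fx := subsetP sxF _ mem_span_const; split.
  - by rewrite -nilres_eq1; apply/eqP/(top1 _ CF).
  - by rewrite groupX.
  by apply: subsetP (Xu g); rewrite cycle_subG.
have sol_f : solvable (span f).
  have [CF sfF _ _] := append2P Cf Cx Cx; exact: solvableS sfF (sol7 CF).
set A := span f in ntf sol_f; pose D := nilser h.+1 A.
have sAG : A \subset G by apply: span_subG => j; rewrite (subsetP sCG).
have nilD : nilpotent D.
  have [CF sfF _ _] := append2P Cf Cx Cx.
  by rewrite -nilres_eq1 -subG1 -(top1 _ CF) (nilserS h.+2 sfF).
(* [D] equals its commutator with [nilser h A], so only a trivial [D] could be centralised by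
   [A]. *)
have ncD : ~~ (D \subset 'C(A)).
  apply: contra ntf => cDA; rewrite /= -nilres_comm -subG1.
  apply: subset_trans (commgS _ (nilser_sub h A)) _.
  by apply/trivgP/commG1P.
(* An element of [D] outside ['C(A)] is the product of its primary components, so one of these is
   outside too. *)
have [w [p [Dw pw ncw]]] : exists w (p : nat), [/\ w \in D, p.-elt w & w \notin 'C(A)].
  have [d Dd ncd] := subsetPn ncD.
  have [/existsP[q ncq] | ] := boolP [exists q : 'I_#[d].+1, d.`_q \notin 'C(A)].
    by exists d.`_q, (q : nat); rewrite groupX ?p_elt_constt.
  move/existsPn=> cdA; case/negP: ncd.
  rewrite -(prod_constt d) big_mkord group_prod // => q _.
  by have:= cdA q; rewrite negbK.
have [j ncj] : exists j, [~ w, f j] != 1.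
  apply/existsP; apply: contraNT ncw => /existsPn cwf.
  rewrite -sub_cent1 span_subG // => j; apply/cent1P/commute_sym/commgP.
  by have:= cwf j; rewrite negbK.
have Af : f j \in A := mem_span f j.
have Aw : w \in A := subsetP (nilser_sub _ _) w Dw.
have Gw : w \in G := subsetP sAG w Aw.
have Wu : [~ w, f j] \in 'O_p(D).
  have Ow : w \in 'O_p(D).
    by rewrite (mem_normal_Hall (nilpotent_pcore_Hall p nilD)) ?pcore_normal.
  rewrite commgEl groupMl ?groupV // memJ_norm //.
  apply: (subsetP (char_norm (char_trans (pcore_char p _) (nilser_char h.+1 A)))) => //.
have Du : [~ w, f j] \in D := subsetP (pcore_sub _ _) _ Wu.
exists p, [~ w, f j], h.+1; split=> //; first by rewrite groupR ?(subsetP sAG).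
  exact: mem_p_elt (pcore_pgroup p D) Wu.
move=> g Gg; have CJ y : y \in G -> f j ^ y \in C.
  by move=> Gy; rewrite memJ_norm // (subsetP (class_norm x G)).
(* With [y = f j], conjugating [[~ w, y]] by [g] gives [(y ^ (w * g))^-1 * y ^ g], whence the last
   two entries. *)
have [CF sfF Fa Fb] := append2P Cf (CJ g Gg) (CJ (w * g) (groupM Gw Gg)).
exists (span (append2 f (f j ^ g) (f j ^ (w * g)))); split.
- by rewrite -nilres_eq1; apply/eqP/(top1 _ CF).
- exact: subsetP (nilserS h.+1 sfF) _ Du.
by rewrite commgEr conjMg !conjVg -conjgM groupM ?groupV.
Qed.

(** [u] lies in the [p]-core of [nilser h T], which is normal in [T]; its join with [<[u ^ g]>] is
    therefore a [p]-group, and Baer-Suzuki applies. *)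
Lemma pcore_neq1 : exists p : nat, 'O_p(G) != 1.
Proof.
have [p [u [h [Gu ntu pu Tu]]]] := exists_sub_pelt; exists p.
suffices Ou : u \in 'O_p(G).
  by apply: contraNneq ntu => O1; rewrite O1 inE in Ou.
apply: (Baer_Suzuki Gu) => g Gg; have [T [nilT Tu1 Tug]] := Tu g Gg.
have Ou : u \in 'O_p(nilser h T).
  by rewrite (mem_normal_Hall (nilpotent_pcore_Hall p nilT)) ?pcore_normal.
have nOT : T \subset 'N('O_p(nilser h T)).
  exact: char_norm (char_trans (pcore_char _ _) (nilser_char _ _)).
have pOu : p.-group ('O_p(nilser h T) <*> <[u ^ g]>).
  rewrite norm_joinEr ?cycle_subG ?(subsetP nOT) // pgroupM pcore_pgroup.
  by rewrite -[pgroup _ <[_]>]/(p.-elt (u ^ g)) p_eltJ.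
apply: pgroupS pOu; rewrite gen_subG subUset !sub1set.
by rewrite (subsetP (joing_subl _ _)) // (subsetP (joing_subr _ _)) ?cycle_id.
Qed.

End SolvableSevenfold.

(** Induction on the order of [G]: tuples in the image of the class modulo the [p]-core lift to the
    class, so the quotient inherits the hypothesis. *)
Lemma solvable_class_gen (gT : finGroupType) (G : {group gT}) (x : gT) :
    x \in G ->
    (forall f : {ffun 'I_7 -> gT}, (forall j, f j \in x ^: G) -> solvable (span f)) ->
  solvable <<x ^: G>>.
Proof.
have [n] := ubnP #|G|; elim: n => // n IHn in gT G x * => /ltnSE-leGn Gx sol7.
have [-> | ntx] := eqVneq x 1; first by rewrite class1G genGid solvable1.
have [p ntO] := pcore_neq1 Gx sol7 ntx; pose N := [group of 'O_p(G)].
have nsNG : N <| G := pcore_normal p G; have [sNG nNG] := andP nsNG.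
have nCN : x ^: G \subset 'N(N) := subset_trans (class_subG Gx (subxx G)) nNG.
have solq : solvable (<<x ^: G>> / N).
  rewrite quotient_gen // quotient_class ?(subsetP nNG) //.
  apply: IHn; first by apply: leq_trans leGn; apply: ltn_quotient.
    exact: mem_quotient.
  move=> f; rewrite -quotient_class ?(subsetP nNG) // => Cf.
  have [g Cg <-] := span_lift Cf.
  by rewrite quotient_sol ?sol7.
have nMN : <<x ^: G>> \subset 'N(N) by rewrite gen_subG.
apply: solvableS (joing_subl _ N) _.
have nsNM : N <| <<x ^: G>> <*> N by rewrite normalYr.
rewrite (series_sol nsNM) (pgroup_sol (pcore_pgroup p G)) /=.
by rewrite quotientYidr.
Qed.

Theorem theorem3p8 (gT : finGroupType) (G : {group gT}) (C : {set gT})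
  (hC : C \in classes G)
  (h7 : forall x1 x2 x3 x4 x5 x6 x7 : gT,
      x1 \in C -> x2 \in C -> x3 \in C -> x4 \in C ->
      x5 \in C -> x6 \in C -> x7 \in C ->
      solvable <<[set x1; x2; x3; x4; x5; x6; x7]>>) :
  solvable <<C>>.
Proof.
have [x Gx defC] := imsetP hC; rewrite defC in h7 *.
apply: solvable_class_gen => // f Cf; pose c k := f (inord k : 'I_7).
apply: solvableS (h7 (c 0) (c 1%N) (c 2) (c 3) (c 4) (c 5) (c 6) _ _ _ _ _ _ _);
  rewrite ?Cf //.
apply: span_subG => j; apply: mem_gen; rewrite -[j]inord_val -/(c j) !inE.
by case: j => [[|[|[|[|[|[|[|k]]]]]]] ltj] //=; rewrite eqxx ?orbT.
Qed.
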